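(* Assume that a compact metric group $G$ acts continuously on an $\mathbb{R}$-tree $T$. Then, for any $x\in T$ and $\kappa\in(0,1/4)$, there exists a point $z_{x,\kappa}\in T$ such that $$d_T(z_{x,\kappa},gz_{x,\kappa})\leq \omega_x\Big(+\operatorname{Sep}\Big(G;\kappa,\frac13\Big)\Big)+\rho\Big(\omega_x\Big(+\operatorname{Sep}\Big(G;\kappa,\frac13\Big)\Big)\Big)$$ for any $g\in G$. Put $r:=\lim_{\kappa\uparrow 1/4}\operatorname{Sep}(G;\kappa,\kappa)$. Then, for any $x\in T$, there also exists a point $z_x\in Gx$ such that $$d_T(z_x,gz_x)\leq \min\{2\omega_x(+r)+\rho(+2\omega_x(+r)),\ 2\omega_x(+r)+2\rho(\omega_x(+r))\}$$ for any $g\in G$.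
   Context: A compact metric group $G$ carries a (compatible) metric $d_G$ and the Haar measure $\mu_G$ normalized by $\mu_G(G)=1$. For $\kappa_1,\kappa_2\geq0$, $\operatorname{Sep}(G;\kappa_1,\kappa_2)$ is the supremum of $d_G(A,B)=\inf_{a\in A,b\in B}d_G(a,b)$ over Borel subsets $A,B\subseteq G$ with $\mu_G(A)\geq\kappa_1$, $\mu_G(B)\geq\kappa_2$. For an action of $G$ on a metric space $X$, $\rho(\eta)\in[0,\infty]$ is the supremum of $d_X(gx,gy)$ over all $g\in G$ and $x,y\in X$ with $d_X(x,y)\leq\eta$; and for $x\in X$, $\omega_x(\eta)\in[0,\infty]$ is the supremum of $d_X(gx,g'x)$ over all $g,g'\in G$ with $d_G(g,g')\leq\eta$ (same formulas for $\eta=0$). Write $\rho(+\eta):=\lim_{\eta'\downarrow\eta}\rho(\eta')$ and $\omega_x(+\eta):=\lim_{\eta'\downarrow\eta}\omega_x(\eta')$ for $\eta\geq 0$. $Gx$ is the orbit of $x$. An $\mathbb{R}$-tree is a complete metric space $T$ such that (1) any two points are connected by a unique unit speed geodesic, and (2) the image of every simple path in $T$ is the image of a geodesic. (A geodesic is a rectifiable, constant speed curve whose length equals the distance between its endpoints.) *)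

(* Defs.v *)
From HB Require Import structures.
From mathcomp Require Import all_boot all_order all_algebra.
From mathcomp Require Import all_classical all_reals all_analysis.

Set Implicit Arguments.
Unset Strict Implicit.
Unset Printing Implicit Defensive.

Import Order.TTheory GRing.Theory Num.Theory.
Import numFieldNormedType.Exports.

Local Open Scope classical_set_scope.
Local Open Scope ring_scope.

HB.mixin Record isTopologicalGroup G & Topological G & Group G := {
  mulg_continuous : continuous (fun p : G * G => (p.1 * p.2)%g) ;
  invg_continuous : continuous (fun g : G => (g^-1)%g)
}.

#[short(type="pmetricType")]
HB.structure Definition PointedMetric (R : numDomainType) :=
  { T of Metric R T & Pointed T }.

#[short(type="completeMetricType")]
HB.structure Definition CompleteMetric (R : numDomainType) :=
  { T of Metric R T & Complete T }.

(* A topological group whose topology is that of a metric; the metric is not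
   assumed to be invariant. The base point of [Pointed] carries no information:
   it is there because a [measurableType] must be pointed. *)
#[short(type="metricGroupType")]
HB.structure Definition MetricGroup (R : numDomainType) :=
  { G of PointedMetric R G & Group G & isTopologicalGroup G }.

Definition borel (X : ptopologicalType) := g_sigma_algebraType (@open X).

Section separation.
Context {R : realType} {G : metricGroupType R}.

(* The normalization mu G = 1 is part of [probability]; on a compact group such
   a measure exists and is unique. *)
Definition is_haar (mu : probability (borel G) R) :=
  forall (g : G) (A : set (borel G)), measurable A ->
    mu [set (g * a)%g | a in (A : set G)] = mu A.

(* +oo if A or B is empty. *)
Definition set_dist (A B : set G) : \bar R :=
  ereal_inf [set (mdist a b)%:E | a in A & b in B].

Definition Sep (mu : probability (borel G) R) (k1 k2 : R) : \bar R :=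
  ereal_sup [set set_dist AB.1 AB.2 | AB in
    [set AB : set (borel G) * set (borel G) |
      [/\ measurable AB.1, measurable AB.2,
          (k1%:E <= mu AB.1)%E & (k2%:E <= mu AB.2)%E]]].

End separation.

Section actions.
Context {R : realType} {G : metricGroupType R} {X : metricType R}.
Variable act : G -> X -> X.

Record is_continuous_action : Prop := IsContinuousAction {
  act_1 : forall x, act 1%g x = x ;
  act_M : forall g h x, act (g * h)%g x = act g (act h x) ;
  act_continuous : continuous (fun p : G * X => act p.1 p.2)
}.

Definition act_orbit (x : X) : set X := range (act^~ x).

(* [rho] and [omega] take extended real arguments because they get applied to
   values of [omega] and [Sep], which are extended reals. *)
Definition rho (eta : \bar R) : \bar R :=
  ereal_sup [set (mdist (act p.1 p.2.1) (act p.1 p.2.2))%:E | p in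
    [set p : G * (X * X) | ((mdist p.2.1 p.2.2)%:E <= eta)%E]].

Definition omega (x : X) (eta : \bar R) : \bar R :=
  ereal_sup [set (mdist (act p.1 x) (act p.2 x))%:E | p in
    [set p : G * G | ((mdist p.1 p.2)%:E <= eta)%E]].

End actions.

(* f(+eta), the limit of f eta' as eta' decreases to eta. At eta = +oo the
   filter is degenerate and the value is meaningless. *)
Definition right_lim {R : realType} (f : \bar R -> \bar R) (eta : \bar R) :
    \bar R :=
  lim (f eta' @[eta' --> within (fun y => (eta < y)%E) (nbhs eta)]).

Section curves.
Context {R : realType} {T : metricType R}.
Implicit Types (a b : R) (gamma : R -> T).

Definition polygonal_length a b gamma (s : seq R) : R :=
  let F := gamma \o nth b (a :: s) in
  \sum_(0 <= n < size s) mdist (F n) (F n.+1).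

Definition curve_length a b gamma : \bar R :=
  ereal_sup [set (polygonal_length a b gamma s)%:E | s in itv_partition a b].

Definition is_curve a b gamma :=
  a <= b /\ {within `[a, b], continuous gamma}.

Definition has_speed v a b gamma := forall s t : R,
  a <= s -> s <= t -> t <= b -> curve_length s t gamma = (v * (t - s))%:E.

Definition is_geodesic a b gamma :=
  [/\ is_curve a b gamma,
      (curve_length a b gamma < +oo)%E,
      exists v, has_speed v a b gamma &
      curve_length a b gamma = (mdist (gamma a) (gamma b))%:E].

Definition unit_speed_geodesic (x y : T) (l : R) gamma :=
  [/\ is_geodesic 0 l gamma, has_speed 1 0 l gamma, gamma 0 = x & gamma l = y].

Definition is_simple_path a b gamma :=
  is_curve a b gamma /\ {in `[a, b] &, injective gamma}.

End curves.

Record is_Rtree {R : realType} (T : completeMetricType R) : Prop := IsRtree {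
  Rtree_geodesic_exists : forall x y : T,
    exists l gamma, unit_speed_geodesic x y l gamma ;
  (* Functions representing curves are only relevant on the interval. *)
  Rtree_geodesic_unique : forall (x y : T) l1 gamma1 l2 gamma2,
    unit_speed_geodesic x y l1 gamma1 -> unit_speed_geodesic x y l2 gamma2 ->
    l1 = l2 /\ {in `[0, l1], gamma1 =1 gamma2} ;
  Rtree_simple_path : forall a b (gamma : R -> T), is_simple_path a b gamma ->
    exists a' b' gamma', is_geodesic a' b' gamma' /\
      gamma @` `[a, b] = gamma' @` `[a', b']
}.

(* Main.v *)
Require Import Defs.
From mathcomp Require Import all_boot all_order all_algebra.
From mathcomp Require Import all_classical all_reals all_analysis.
From mathcomp Require Import measurable_realfun lra.

Set Implicit Arguments.
Unset Strict Implicit.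
Unset Printing Implicit Defensive.

Import Order.TTheory GRing.Theory Num.Theory.
Import numFieldNormedType.Exports.

Local Open Scope classical_set_scope.
Local Open Scope ring_scope.

(* A compact group acting on an R-tree fixes a point. Homeomorphisms of the tree
   map geodesics onto geodesics, so the Haar average of the distances
   d(g^-1 p, g^-1 q) is an invariant distance which is still additive along
   geodesics, and the center c of the orbit Gx for it is fixed. This settles the
   first claim. Moreover c is the midpoint of two orbit points, so if c is not
   itself in Gx, the orbit meets at least two branches of the tree at c. The
   group permutes these branches transitively, hence they pull back to open
   subsets of G of the same measure, at most 1/2, and can be grouped into two
   families A, B of measure at least 1/4. Then d(A, B) <= r, and the geodesic
   from ax to bx passes through c for a in A and b in B, so some z in Gx
   satisfies d(z, c) <= w := omega_x(+r). As c is fixed,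
   d(z, gz) <= d(z, c) + d(gc, gz) <= w + rho(w), which is below both bounds. *)

(** * Curves, their lengths and geodesics *)

Section curves.
Context {R : realType} {T : metricType R}.
Implicit Types (a b s t v : R) (gamma : R -> T).

Lemma lipschitz_within_continuous a b gamma :
  (forall s t, a <= s -> s <= t -> t <= b -> mdist (gamma s) (gamma t) <= t - s) ->
  {within `[a, b], continuous gamma}.
Proof.
move=> lip; apply/subspace_continuousP => s /=; rewrite in_itv/= => /andP[as_ sb].
apply/(@metricType_numDomainType.cvgrPdist_lt R T) => e e0.
have H := @cvgr_dist_lt R _ _ (within `[a, b] (nbhs s)) _ id s
  (@cvg_within _ _ _ _) e e0.
near=> t.
have : t \in `[a, b] by near: t; exact: withinT.
rewrite in_itv/= => /andP[at_ tb].
have : `|s - t| < e by near: t; exact: H.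
apply: le_lt_trans; have [st|/ltW ts] := leP s t.
  by rewrite (le_trans (lip _ _ _ _ _))// distrC ler_norm.
by rewrite metric_sym (le_trans (lip _ _ _ _ _))// ler_norm.
Unshelve. all: by end_near. Qed.

Lemma mdist_le_curve_length s t gamma : s <= t ->
  ((mdist (gamma s) (gamma t))%:E <= curve_length s t gamma)%E.
Proof.
rewrite le_eqVlt => /predU1P[<-|st]; apply: ereal_sup_ubound => /=.
  by exists [::]; rewrite /itv_partition//= /polygonal_length big_geq// mdistxx.
exists [:: t]; first exact: itv_partition1.
by rewrite /polygonal_length/= big_nat1.
Qed.

(** The pieces before, between and after [s] and [t] are each at least as long as their chords, and
    their lengths add up to the distance between the endpoints; the triangle inequality forces
    equality on each piece. *)
Lemma has_speed_mdist v a b gamma : has_speed v a b gamma ->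
  curve_length a b gamma = (mdist (gamma a) (gamma b))%:E ->
  forall s t, a <= s -> s <= t -> t <= b ->
    mdist (gamma s) (gamma t) = v * (t - s).
Proof.
move=> sp len s t as_ st tb.
have le s' t' : a <= s' -> s' <= t' -> t' <= b ->
    mdist (gamma s') (gamma t') <= v * (t' - s').
  by move=> ? ? ?; rewrite -lee_fin -sp// mdist_le_curve_length.
have ab : v * (b - a) = mdist (gamma a) (gamma b).
  by apply: EFin_inj; rewrite -len sp//; lra.
have h1 := le a s (lexx _) as_ ltac:(lra).
have h2 := le s t as_ st tb.
have h3 := le t b ltac:(lra) tb (lexx _).
have h4 := metric_triangle (gamma a) (gamma s) (gamma b).
have h5 := metric_triangle (gamma s) (gamma t) (gamma b).
apply/eqP; rewrite eq_le h2/=.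
have e : v * (b - a) = v * (s - a) + v * (t - s) + v * (b - t).
  by rewrite -!mulrDr; congr (_ * _); lra.
lra.
Qed.

Lemma polygonal_length_cons a b c gamma (s : seq R) :
  polygonal_length a b gamma (c :: s) =
  mdist (gamma a) (gamma c) + polygonal_length c b gamma s.
Proof. by rewrite /polygonal_length/= big_nat_recl. Qed.

(** Along such a curve every polygonal sum telescopes to the same value. *)
Lemma isometric_curve_length v a b gamma :
  (forall s t, a <= s -> s <= t -> t <= b ->
    mdist (gamma s) (gamma t) = v * (t - s)) ->
  a <= b -> curve_length a b gamma = (v * (b - a))%:E.
Proof.
move=> iso ab.
have pl (s : seq R) : itv_partition a b s -> polygonal_length a b gamma s = v * (b - a).
  move: iso ab; elim: s a => [|c s IH] a iso ab.
    by move/itv_partition_nil <-; rewrite /polygonal_length big_geq// subrr mulr0.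
  move=> /[dup] ps /itv_partition_cons /[dup] pc /itv_partition_le cb.
  have ac : a <= c by case: ps => /= /andP[/ltW].
  rewrite polygonal_length_cons iso// IH//; last first.
    by move=> s' t' cs st tb; apply: iso => //; exact: le_trans cs.
  by rewrite -mulrDr; congr (_ * _); lra.
apply/eqP; rewrite eq_le; apply/andP; split.
  by apply: ge_ereal_sup => _ [s /pl <- <-].
by rewrite -iso// mdist_le_curve_length.
Qed.

(** Turns an isometric parametrization, which is what gluing produces, into a geodesic to which the
    uniqueness in [is_Rtree] applies. *)
Lemma isometric_unit_speed_geodesic l gamma : 0 <= l ->
  (forall s t, 0 <= s -> s <= t -> t <= l ->
    mdist (gamma s) (gamma t) = t - s) ->
  unit_speed_geodesic (gamma 0) (gamma l) l gamma.
Proof.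
move=> l0 iso.
have iso1 s t : 0 <= s -> s <= t -> t <= l ->
    mdist (gamma s) (gamma t) = 1 * (t - s).
  by rewrite mul1r; exact: iso.
have len s t : 0 <= s -> s <= t -> t <= l ->
    curve_length s t gamma = (1 * (t - s))%:E.
  move=> s0 st tl; apply: isometric_curve_length => // s' t' ss' s't' t't.
  by apply: iso1 => //; [exact: le_trans ss'|exact: le_trans tl].
split => //; split.
- split=> //; apply: lipschitz_within_continuous => s t s0 st tl.
  by rewrite iso.
- by rewrite len// ltry.
- by exists 1.
- by rewrite len// iso1.
Qed.

End curves.

(** * Metric betweenness *)

Definition between {R : realType} {T : metricType R} (x m y : T) : Prop :=
  mdist x m + mdist m y = mdist x y.

Section between.
Context {R : realType} {T : metricType R}.
Implicit Types x y m n : T.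

Lemma between_sym x m y : between x m y -> between y m x.
Proof.
by rewrite /between addrC (metric_sym m x) (metric_sym y m) (metric_sym y x).
Qed.

Lemma between_trans x n m y : between x n m -> between x m y -> between x n y.
Proof.
rewrite /between => h1 h2.
have := metric_triangle n m y; have := metric_triangle x n y; lra.
Qed.

End between.

(** * Geodesics and simple paths in an R-tree *)

Section Rtree.
Context {R : realType} {T : completeMetricType R}.
Hypothesis treeT : is_Rtree T.
Implicit Types (x y p q m n : T) (gamma : R -> T).

Lemma Rtree_isometric_geodesic x y : exists gamma,
  [/\ gamma 0 = x, gamma (mdist x y) = y &
      forall s t, 0 <= s -> s <= t -> t <= mdist x y ->
        mdist (gamma s) (gamma t) = t - s].
Proof.
have [l [gamma [[[l0 _] _ _ len] sp g0 gl]]] := Rtree_geodesic_exists treeT x y.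
have iso := has_speed_mdist sp len.
have lE : l = mdist x y by rewrite -g0 -gl iso// mul1r subr0.
by exists gamma; split=> [//||s t s0 st tl]; rewrite -?lE// iso// ?mul1r// lE.
Qed.

(** Gluing geodesics from [p] to a point in between and from there to [q] gives a geodesic from [p]
    to [q]. By uniqueness those through [m] and through [n] coincide, and both points sit at the
    same parameter. *)
Lemma between_unique p q m n : between p m q -> between p n q ->
  mdist p m = mdist p n -> m = n.
Proof.
move=> bm bn mn.
have geo z : between p z q -> exists2 gamma,
    unit_speed_geodesic p q (mdist p q) gamma & gamma (mdist p z) = z.
  move=> bz.
  have [g1 [g10 g1l iso1]] := Rtree_isometric_geodesic p z.
  have [g2 [g20 g2l iso2]] := Rtree_isometric_geodesic z q.
  pose g s := if s <= mdist p z then g1 s else g2 (s - mdist p z).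
  have gz : g (mdist p z) = z by rewrite /g lexx.
  have gp : g 0 = p by rewrite /g mdist_ge0.
  have gge s : mdist p z <= s -> g s = g2 (s - mdist p z).
    rewrite /g le_eqVlt => /predU1P[<-|]; first by rewrite lexx subrr g20.
    by rewrite ltNge => /negbTE ->.
  have gq : g (mdist p q) = q.
    rewrite gge; last by rewrite -bz lerDl mdist_ge0.
    by rewrite -[X in g2 (X - _)]bz addrAC subrr add0r.
  have h0 := mdist_ge0 p z.
  have h0' := mdist_ge0 z q.
  exists g => //.
  rewrite -[X in unit_speed_geodesic X]gp -[X in unit_speed_geodesic _ X]gq.
  rewrite -bz in gq *.
  have le s t : 0 <= s -> s <= t -> t <= mdist p z + mdist z q ->
      mdist (g s) (g t) <= t - s.
    move=> s0 st tl.
    have [tz|/ltW zt] := leP t (mdist p z).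
      by rewrite /g tz (le_trans st tz) iso1.
    have [sz|/ltW zs] := leP s (mdist p z); last first.
      rewrite !gge// iso2; lra.
    apply: (le_trans (metric_triangle _ z _)).
    rewrite -[X in mdist _ X + _]g1l -[X in _ + mdist X _]g20 (gge t)// /g sz.
    by rewrite iso1 ?iso2//; lra.
  apply: isometric_unit_speed_geodesic; first lra.
  (* A 1-Lipschitz path whose ends are as far apart as its parameter interval is long cannot shorten
     any subinterval. *)
  move=> s t s0 st tl; apply/eqP; rewrite eq_le le//=.
  have h1 := le 0 s (lexx _) s0 ltac:(lra).
  have h3 := le t _ ltac:(lra) tl (lexx _).
  have h4 := metric_triangle (g 0) (g s) (g t).
  have h5 := metric_triangle (g 0) (g t) (g (mdist p z + mdist z q)).
  move: h1 h3 h4 h5; rewrite gp gq -bz; lra.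
have [g1 gg1 g1m] := geo m bm.
have [g2 gg2 g2n] := geo n bn.
have [_ /(_ (mdist p m))] := Rtree_geodesic_unique treeT gg1 gg2.
rewrite g1m mn g2n; apply; rewrite in_itv/= mdist_ge0/= -bn lerDl mdist_ge0//.
Qed.

(* On the image of the path, the distance to one end of the geodesic with the
   same image is continuous and injective in the parameter, hence monotone. *)
Lemma simple_path_between a b gamma t : is_simple_path a b gamma ->
  a <= t <= b -> between (gamma a) (gamma t) (gamma b).
Proof.
move=> /[dup] sg [[ab cg] ig] tab.
have [a' [b' [g [[[ab' cg'] _ [v sp] len] im]]]] := Rtree_simple_path treeT sg.
have iso := has_speed_mdist sp len.
have v0 s u : a' <= s -> s <= u -> u <= b' -> 0 <= v * (u - s).
  by move=> ? ? ?; rewrite -iso// mdist_ge0.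
have ga s : a' <= s -> s <= b' -> mdist (g a') (g s) = v * (s - a').
  by move=> ? ?; rewrite iso.
pose h s := mdist (g a') (gamma s).
(* The image lies on a geodesic, so [h] maps it isometrically into the line, and betweenness reduces
   to monotonicity of [h]. *)
have hg s u : a <= s <= b -> a <= u <= b ->
    mdist (gamma s) (gamma u) = `|h s - h u|.
  move=> sab uab; rewrite /h.
  have : (gamma @` `[a, b]) (gamma s) by exists s => //=; rewrite in_itv.
  have : (gamma @` `[a, b]) (gamma u) by exists u => //=; rewrite in_itv.
  rewrite im => -[u' + <-]; rewrite /= in_itv/= => /andP[au' ub'].
  move=> -[s' + <-]; rewrite /= in_itv/= => /andP[as' sb'].
  rewrite !ga// -mulrBr.
  have -> : s' - a' - (u' - a') = s' - u' by lra.
  have [su|/ltW us] := leP s' u'.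
    by rewrite iso// -normrN -mulrN opprB ger0_norm// v0.
  by rewrite metric_sym iso// ger0_norm// v0.
have hab : {in `[a, b] &, injective h}.
  move=> s u; rewrite !in_itv/= => sab uab hsu; apply: ig; rewrite ?inE/= ?in_itv//.
  by apply: mdist_positivity; rewrite hg// hsu subrr normr0.
have hc : {within `[a, b], continuous h}.
  move/subspace_continuousP in cg; apply/subspace_continuousP => s sab.
  apply/cvgrPdist_lt => e e0.
  have /(@metricType_numDomainType.cvgrPdist_lt R T)/(_ _ e0) := cg s sab.
  rewrite !near_withinE; apply: filterS => u + uab => /(_ uab).
  by move: sab uab => /=; rewrite !in_itv/= => sab uab; rewrite hg.
move/andP: (tab) => [at_ tb].
rewrite /between !hg ?lexx ?ab//.
have /orP[hle|hge] := le_total (h a) (h b).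
  have mono := segment_continuous_inj_le hle hc hab.
  have h1 : h a <= h t by rewrite mono ?in_itv/= ?lexx ?ab.
  have h2 : h t <= h b by rewrite mono ?in_itv/= ?lexx ?ab.
  rewrite !ler0_norm; lra.
have mono := segment_continuous_inj_ge hge hc hab.
have h1 : h a >= h t by rewrite mono ?in_itv/= ?lexx ?ab.
have h2 : h t >= h b by rewrite mono ?in_itv/= ?lexx ?ab.
rewrite !ger0_norm; lra.
Qed.

End Rtree.

(** * Medians and branching in an R-tree *)

Section Rtree_branching.
Context {R : realType} {T : completeMetricType R}.
Hypothesis treeT : is_Rtree T.
Implicit Types (x y p q m n : T) (gamma : R -> T).

(** The geodesic from [p] to [q] passes through [m], and its image under [f] is a simple path, all
    of whose points lie between its ends. *)
Lemma homeo_between (f : T -> T) p m q : continuous f -> injective f ->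
  between p m q -> between (f p) (f m) (f q).
Proof.
move=> cf fi bm.
have [g [g0 gl iso]] := Rtree_isometric_geodesic treeT p q.
have pm : 0 <= mdist p m <= mdist p q by rewrite mdist_ge0 -bm lerDl mdist_ge0.
have gm : g (mdist p m) = m.
  move/andP: (pm) => [h1 h2].
  have e : mdist p (g (mdist p m)) = mdist p m.
    by rewrite -{1}g0 iso// ?mdist_ge0// subr0.
  apply: (between_unique treeT _ bm) => //.
  rewrite /between e.
  rewrite -[X in _ + mdist _ X]gl iso//; lra.
rewrite -{1}g0 -{1}gl -{1}gm.
apply: (@simple_path_between _ _ treeT 0 (mdist p q) (f \o g)) => //.
split; first split; first exact: mdist_ge0.
  move=> s; apply: (@continuous_comp (subspace `[0, mdist p q]) T T g f); last exact: cf.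
  apply: lipschitz_within_continuous => s' t' s0 st tl; by rewrite iso.
move=> s t; rewrite !in_itv/= => /andP[s0 sl] /andP[t0 tl] /fi gst.
have [st|/ltW ts] := leP s t.
  have := iso s t s0 st tl; rewrite gst mdistxx; lra.
have := iso t s t0 ts sl; rewrite gst mdistxx; lra.
Qed.

(* The geodesics from y agree up to a last common point m, and beyond it they
   form a simple path from p to q. *)
Lemma exists_median y p q :
  exists m, [/\ between y m p, between y m q & between p m q].
Proof.
have [g1 [g10 g1l iso1]] := Rtree_isometric_geodesic treeT y p.
have [g2 [g20 g2l iso2]] := Rtree_isometric_geodesic treeT y q.
set l1 := mdist y p in g1l iso1 *; set l2 := mdist y q in g2l iso2 *.
have l10 : 0 <= l1 by exact: mdist_ge0.
have l20 : 0 <= l2 by exact: mdist_ge0.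
have dist1 t : 0 <= t -> t <= l1 -> mdist y (g1 t) = t.
  by move=> ? ?; rewrite -g10 iso1// subr0.
have dist2 t : 0 <= t -> t <= l2 -> mdist y (g2 t) = t.
  by move=> ? ?; rewrite -g20 iso2// subr0.
(* The parameters at which the two geodesics meet; the last one, [u], yields the median [g1 u]. *)
pose S : set R := [set t | [/\ 0 <= t, t <= l1, t <= l2 & g1 t = g2 t]].
have S0 : S 0 by split; rewrite ?g10.
have hS : has_sup S.
  by split; [exists 0|exists l1 => t []].
pose u := sup S.
have u0 : 0 <= u by apply: ub_le_sup => //; case: hS.
have u1 : u <= l1 by apply: ge_sup; [exists 0|move=> t []].
have u2 : u <= l2 by apply: ge_sup; [exists 0|move=> t []].
(* Both geodesics are 1-Lipschitz and agree at times arbitrarily close to [u], so the supremum is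
   attained. *)
have Su : g1 u = g2 u.
  apply: mdist_positivity; apply/eqP; rewrite eq_le mdist_ge0 andbT.
  apply/ler_addgt0Pl => e e0; rewrite addr0.
  have e20 : 0 < e / 2 by rewrite divr_gt0.
  have [t [t0 t1 t2 gt] ut] := sup_adherent e20 hS.
  have tu : t <= u by apply: ub_le_sup => //; case: hS.
  apply: (le_trans (metric_triangle _ (g1 t) _)).
  rewrite metric_sym iso1// gt iso2//.
  rewrite -/u in ut; lra.
have d1 s t : 0 <= s -> s <= t -> t <= l1 -> mdist (g1 t) (g1 s) = t - s.
  by move=> ? ? ?; rewrite metric_sym iso1.
(* The path from [p] at time [u - l1], through the median at time 0, to [q] at time [l2 - u]. *)
pose g s := if s <= 0 then g1 (u - s) else g2 (u + s).
have gge s : 0 <= s -> g s = g2 (u + s).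
  rewrite /g le_eqVlt => /predU1P[<-|]; first by rewrite lexx subr0 addr0.
  by rewrite ltNge => /negbTE ->.
have gle s : s <= 0 -> g s = g1 (u - s) by rewrite /g => ->.
have yg s : u - l1 <= s -> s <= l2 - u -> mdist y (g s) = u + `|s|.
  move=> h1 h2; have [s0|/ltW s0] := leP s 0.
    by rewrite gle// dist1 ?ler0_norm//; lra.
  by rewrite gge// dist2 ?ger0_norm//; lra.
have lip s t : u - l1 <= s -> s <= t -> t <= l2 - u ->
    mdist (g s) (g t) <= t - s.
  move=> sl st tl; have [t0|/ltW t0] := leP t 0.
    rewrite !gle//; last exact: le_trans t0.
    rewrite d1; lra.
  have [s0|/ltW s0] := leP s 0; last first.
    rewrite !gge// iso2; lra.
  apply: (le_trans (metric_triangle _ (g 0) _)).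
  rewrite gle// gle// gge// -(subr0 0) d1; try lra.
  rewrite subrr subr0 Su iso2; lra.
(* Equal points are equally far from [y], so the times agree up to sign; opposite nonzero times
   would make the geodesics meet after [u]. *)
have inj s t : u - l1 <= s -> s <= t -> t <= l2 - u -> g s = g t -> s = t.
  move=> sl st tl gst.
  have := yg s sl (le_trans st tl); rewrite gst yg ?(le_trans sl)// => /addrI.
  have [t0|/ltW t0] := leP t 0.
    rewrite !ler0_norm ?(le_trans st)//; lra.
  have [s0|s0] := leP s 0; last first.
    rewrite !ger0_norm// ?ltW//; lra.
  rewrite ger0_norm// ler0_norm// => ts.
  move: gst; rewrite gle// gge// -ts => gst.
  have : u + t <= u.
    by apply: ub_le_sup; [case: hS|split=> //; lra].
  lra.
exists (g1 u); split.
- by rewrite /between dist1// -{1}g1l iso1// /l1; lra.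
- by rewrite /between Su dist2// -{1}g2l iso2// /l2; lra.
- have := @simple_path_between _ _ treeT (u - l1) (l2 - u) g 0.
  rewrite [g (u - l1)]gle; last lra.
  rewrite [g (l2 - u)]gge; last lra.
  have -> : u - (u - l1) = l1 by lra.
  have -> : u + (l2 - u) = l2 by lra.
  rewrite gle// subr0 g1l g2l; apply; last lra.
  split; first split; first lra.
    exact: lipschitz_within_continuous.
  move=> s t; rewrite !in_itv/= => /andP[s1 s2] /andP[t1 t2] gst.
  have [st|/ltW ts] := leP s t; first exact: inj.
  by apply/esym/inj.
Qed.

(** The median [n] of [p], [q] and [y] cuts the geodesic from [p] to [q] in two. The point [m] lies
    on one of the halves, and the geodesic from the end of that half to [y] runs along it. *)
Lemma between_branch p m q y : between p m q -> between p m y \/ between y m q.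
Proof.
move=> bm; have [n [ypn yqn pqn]] := exists_median y p q.
have aux p' q' : between y n p' -> between p' n q' -> between p' m q' ->
    mdist p' m <= mdist p' n -> between p' m y.
  move=> ypn' pqn' bm' le.
  have [g [g0 gl iso]] := Rtree_isometric_geodesic treeT p' n.
  have pg : mdist p' (g (mdist p' m)) = mdist p' m.
    by rewrite -{1}g0 iso// ?mdist_ge0// subr0.
  have bg : between p' (g (mdist p' m)) n.
    by rewrite /between pg -[X in _ + mdist _ X]gl iso ?mdist_ge0// addrC subrK.
  have -> : m = g (mdist p' m).
    by apply: (between_unique treeT bm' (between_trans bg pqn')).
  by apply: (between_trans bg); exact: between_sym.
have [le|/ltW ge] := leP (mdist p m) (mdist p n).
  by left; exact: (aux p q).
right; apply: between_sym; apply: (aux q p) => //; try exact: between_sym.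
move: bm pqn; rewrite /between (metric_sym q m) (metric_sym q n); lra.
Qed.

End Rtree_branching.

(** * Joint continuity *)

Lemma continuous_comp2 {W X Y Z : topologicalType} (op : X * Y -> Z)
    (f : W -> X) (h : W -> Y) :
  continuous op -> continuous f -> continuous h ->
  continuous (fun w => op (f w, h w)).
Proof.
move=> cop cf ch w.
apply: (@continuous_comp _ _ _ (fun w => (f w, h w)) op); last exact: cop.
by apply: cvg_pair; [exact: cf|exact: ch].
Qed.

Lemma mdist_continuous {R : realType} {T : metricType R} :
  continuous (fun p : T * T => mdist p.1 p.2).
Proof.
move=> -[x y]; apply/cvgrPdist_lt => /= e e0.
have e20 : 0 < e / 2 by rewrite divr_gt0.
exists (ball x (e / 2), ball y (e / 2)); first by split; exact: nbhsx_ballx.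
move=> [x' y'] /= [] ; rewrite !ballEmdist/= => xx' yy'.
rewrite ltr_norml; apply/andP; split.
- have := metric_triangle x' x y'; have := metric_triangle x y y'.
  rewrite (metric_sym x' x); lra.
- have := metric_triangle x x' y; have := metric_triangle x' y' y.
  rewrite (metric_sym y' y); lra.
Qed.

(** * Averages for the Haar measure *)

Section group.
Context {R : realType} {G : metricGroupType R}.
Variable mu : probability (borel G) R.
Hypothesis compactG : compact [set: G].
Hypothesis haar_mu : is_haar mu.
Implicit Types (g h : G) (F : G -> R).

Lemma lmul_continuous h : continuous (fun g : G => (h * g)%g).
Proof.
by apply: (continuous_comp2 mulg_continuous) => [|g]; [exact: cst_continuous|].
Qed.

Lemma compact_continuous_bounded F : continuous F ->
  exists M, forall g, `|F g| <= M.
Proof.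
move=> cF; have G0 : [set: G] !=set0 by exists 1%g.
have cG : {within [set: G], continuous (fun g => `|F g|)}.
  apply: continuous_subspaceT => g; apply: continuous_comp; first exact: cF.
  exact: norm_continuous.
have [c _ cmax] := compact_EVT_max G0 compactG cG.
by exists `|F c| => g; apply: cmax; rewrite inE.
Qed.

Lemma continuous_borel_measurable F : continuous F ->
  measurable_fun [set: borel G] (F : borel G -> R).
Proof.
move=> /continuousP cF; apply: (measurability _ (RGenOpens.measurableE R)).
move=> _ [_ [a [b ->] <-]]; rewrite setTI.
by apply: sub_sigma_algebra; apply: cF; exact: interval_open.
Qed.

Lemma continuous_integrable F : continuous F ->
  mu.-integrable [set: borel G] (EFin \o (F : borel G -> R)).
Proof.
move=> cF; apply: measurable_bounded_integrable => //.
- by rewrite [X in (X < _)%E](@probability_setT _ _ _ mu) ltry.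
- exact: continuous_borel_measurable.
- have [M FM] := compact_continuous_bounded cF.
  by exists M; split=> [|y My g _ /=]; [exact: num_real|rewrite (le_trans (FM g)) ?ltW].
Qed.

Definition haar_mean F : R := \int[mu]_(g in [set: borel G]) F g.

Lemma haar_mean_cst (k : R) : haar_mean (fun=> k) = k.
Proof. by rewrite /haar_mean Rintegral_cst// [X in fine X](@probability_setT _ _ _ mu) mulr1. Qed.

Lemma haar_meanD F1 F2 : continuous F1 -> continuous F2 ->
  haar_mean (fun g => F1 g + F2 g) = haar_mean F1 + haar_mean F2.
Proof. by move=> *; rewrite /haar_mean RintegralD//; exact: continuous_integrable. Qed.

Lemma le_haar_mean F1 F2 : continuous F1 -> continuous F2 ->
  (forall g, F1 g <= F2 g) -> haar_mean F1 <= haar_mean F2.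
Proof.
by move=> *; rewrite /haar_mean le_Rintegral//; exact: continuous_integrable.
Qed.

(** The minimum over the compact group is positive and bounds the mean from below. *)
Lemma haar_mean_gt0 F : continuous F -> (forall g, 0 < F g) -> 0 < haar_mean F.
Proof.
move=> cF F0; have G0 : [set: G] !=set0 by exists 1%g.
have [c _ cmin] := compact_EVT_min G0 compactG (continuous_subspaceT cF).
apply: (@lt_le_trans _ _ (F c)) => //; rewrite -[leLHS]haar_mean_cst.
by apply: le_haar_mean => // [|g]; [exact: cst_continuous|apply: cmin; rewrite inE].
Qed.

Lemma lmul_measurable h :
  measurable_fun [set: borel G] ((fun g => (h * g)%g) : borel G -> borel G).
Proof.
apply: (@measurability _ _ (borel G) (borel G) _ _ open) => //.
move=> _ [B oB <-]; rewrite setTI.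
apply: sub_sigma_algebra; move/continuousP: (@lmul_continuous h); exact.
Qed.

Lemma haar_lmul h (A : set G) : measurable (A : set (borel G)) ->
  mu [set g | A (h * g)%g] = mu A.
Proof.
move=> mA; rewrite -(haar_mu h^-1%g mA); congr (mu _).
apply/seteqP; split=> [g Ahg|_ [a Aa <-]]/=; last by rewrite mulgA mulgV mul1g.
by exists (h * g)%g => //; rewrite mulgA mulVg mul1g.
Qed.

(** The left side is an integral against the pushforward of [mu] under left translation, which is
    [mu] by invariance. *)
Lemma haar_mean_lmul h F : continuous F -> (forall g, 0 <= F g) ->
  haar_mean (fun g => F (h * g)%g) = haar_mean F.
Proof.
move=> cF F0; rewrite /haar_mean /Rintegral; congr fine.
transitivity (\int[pushforward mu ((fun g => (h * g)%g) : borel G -> borel G)]_(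
    g in [set: borel G]) (F g)%:E)%E.
  rewrite ge0_integral_pushforward//.
  - exact: lmul_measurable.
  - by apply/measurable_EFinP; exact: (continuous_borel_measurable cF).
  - by move=> g _; rewrite lee_fin.
apply: eq_measure_integral => [|mphi A mA _]; first exact: lmul_measurable.
exact: (haar_lmul h mA).
Qed.

End group.

(** * The averaged distance and a fixed point *)

Section action.
Context {R : realType} {G : metricGroupType R} {T : completeMetricType R}.
Variables (mu : probability (borel G) R) (act : G -> T -> T).
Hypothesis compactG : compact [set: G].
Hypothesis haar_mu : is_haar mu.
Hypothesis treeT : is_Rtree T.
Hypothesis act_cont : is_continuous_action act.
Implicit Types (g h : G) (x y p q m : T).

Lemma actK g : cancel (act g) (act g^-1%g).
Proof. by move=> x; rewrite -(act_M act_cont) mulVg (act_1 act_cont). Qed.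

Lemma act_continuousl x : continuous (act^~ x).
Proof.
apply: (continuous_comp2 (act_continuous act_cont)) => [g|]; first exact: cvg_id.
exact: cst_continuous.
Qed.

Lemma act_continuousr g : continuous (act g).
Proof.
apply: (continuous_comp2 (act_continuous act_cont)) => [|x]; last exact: cvg_id.
exact: cst_continuous.
Qed.

Lemma act_between g p m q :
  between p m q -> between (act g p) (act g m) (act g q).
Proof.
by apply: homeo_between => //; [exact: act_continuousr|exact: can_inj (actK g)].
Qed.

(** Because of the inverses, moving both points by [h] amounts to a left translation of the
    integration variable by [h^-1], and [mu] is left invariant. *)
Definition mean_dist p q : R :=
  haar_mean mu (fun g => mdist (act g^-1%g p) (act g^-1%g q)).

Lemma orbit_dist_continuous p q :
  continuous (fun g => mdist (act g^-1%g p) (act g^-1%g q)).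
Proof.
have ci x : continuous (fun g : G => act g^-1%g x).
  move=> g; apply: (@continuous_comp _ _ _ (fun g : G => g^-1%g) (act^~ x)).
    exact: invg_continuous.
  exact: act_continuousl.
exact: (continuous_comp2 mdist_continuous).
Qed.
Hint Resolve orbit_dist_continuous : core.

Lemma mean_dist_sym p q : mean_dist p q = mean_dist q p.
Proof. by congr (haar_mean mu); apply/funext => g; rewrite metric_sym. Qed.

Lemma mean_dist_eq0 p q : mean_dist p q <= 0 -> p = q.
Proof.
move=> d0; apply/eqP; apply: contraT => pq; move: d0; rewrite leNgt => /negP; case.
apply: haar_mean_gt0 => // g; rewrite mdist_gt0.
by rewrite (inj_eq (can_inj (actK g^-1%g))).
Qed.

Lemma mean_dist_triangle p m q : mean_dist p q <= mean_dist p m + mean_dist m q.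
Proof.
rewrite -haar_meanD//; apply: le_haar_mean => //.
  by move=> g; apply: cvgD; exact: orbit_dist_continuous.
by move=> g; exact: metric_triangle.
Qed.

(* A homeomorphism of a tree preserves betweenness, although not distances. *)
Lemma mean_dist_between p m q : between p m q ->
  mean_dist p m + mean_dist m q = mean_dist p q.
Proof.
move=> b; rewrite -haar_meanD//; congr (haar_mean mu); apply/funext => g.
exact: act_between.
Qed.

Lemma mean_dist_act h p q : mean_dist (act h p) (act h q) = mean_dist p q.
Proof.
rewrite [RHS](esym (haar_mean_lmul haar_mu h^-1%g _ _))//; last first.
  by move=> g; exact: mdist_ge0.
congr (haar_mean mu); apply/funext => g.
by rewrite invgM invgK !(act_M act_cont).
Qed.

(** By compactness of the group, for [q'] near [q] the integrand comparing [q] and [q'] is at most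
    [e] for all [g] at once, hence so is its mean; the triangle inequality does the rest. *)
Lemma mean_dist_continuous p : continuous (mean_dist p).
Proof.
move=> q; apply/cvgrPdist_le => e e0.
have near_q : \forall q' \near q, [set: G] `<=`
    [set g | mdist (act g^-1%g q) (act g^-1%g q') <= e].
  move/compact_near_coveringP : compactG.
  apply => g _.
  have c : continuous (fun w : G * T => mdist (act w.1^-1%g q) (act w.1^-1%g w.2)).
    have ci : continuous (fun w : G * T => w.1^-1%g).
      move=> w; apply: (@continuous_comp _ _ _ fst (fun g : G => g^-1%g)).
        exact: cvg_fst.
      exact: invg_continuous.
    apply: (continuous_comp2 mdist_continuous).
      move=> w; apply: (@continuous_comp _ _ _ (fun w : G * T => w.1^-1%g) (act^~ q)).
        exact: ci.
      exact: act_continuousl.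
    apply: (continuous_comp2 (act_continuous act_cont)) => //.
    by move=> w; exact: cvg_snd.
  have /cvgrPdist_le/(_ _ e0) := c (g, q).
  apply: filterS => -[g' q'] /=.
  by rewrite mdistxx sub0r normrN ger0_norm ?mdist_ge0.
near=> q'.
have le : mean_dist q q' <= e.
  rewrite -[leRHS](haar_mean_cst mu); apply: le_haar_mean => //.
    exact: cst_continuous.
  by move=> g; have := near near_q q'; apply.
have h1 := mean_dist_triangle p q q'.
have h2 := mean_dist_triangle p q' q.
rewrite (mean_dist_sym q' q) in h2.
rewrite ler_norml; apply/andP; split; lra.
Unshelve. all: by end_near. Qed.

(* The fixed point is the center of the orbit for the averaged distance, which
   is invariant and additive along geodesics. *)
Lemma orbit_center x : exists c, (forall g, act g c = c) /\
  exists h, between x c (act h x).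
Proof.
have G0 : [set: G] !=set0 by exists 1%g.
have cd : continuous (fun g => mean_dist x (act g x)).
  move=> g; apply: (@continuous_comp _ _ _ (act^~ x) (mean_dist x)).
    exact: act_continuousl.
  exact: mean_dist_continuous.
have [h _ hmax] := compact_EVT_max G0 compactG (continuous_subspaceT cd).
have {}hmax g : mean_dist x (act g x) <= mean_dist x (act h x).
  by apply: hmax; rewrite inE.
set D := mean_dist x (act h x) in hmax *.
have [gam [gam0 gaml iso]] := Rtree_isometric_geodesic treeT x (act h x).
set l := mdist x (act h x) in gaml iso *.
have l0 : 0 <= l by exact: mdist_ge0.
have mxx : mean_dist x x = 0.
  by rewrite /mean_dist; under [X in haar_mean _ X]funext do rewrite mdistxx;
    exact: haar_mean_cst.
have D0 : 0 <= D by rewrite -mxx -{2}(act_1 act_cont x).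
have cg : {within `[0, l], continuous (fun t => mean_dist x (gam t))}.
  move=> t; apply: (@continuous_comp (subspace `[0, l]) T R gam (mean_dist x)).
    apply: lipschitz_within_continuous => s u s0 su ul.
    by rewrite iso.
  exact: mean_dist_continuous.
(* Along the geodesic the averaged distance from [x] runs continuously from 0 to its maximum [D], so
   some point [c] is a midpoint for it. *)
have [|t t0l tD] := IVT (v := D / 2) l0 cg.
  by rewrite gam0 gaml mxx min_l// max_r// -/D; apply/andP; split; lra.
move: t0l; rewrite in_itv/= => /andP[t0 tl].
set c := gam t in tD.
have bc : between x c (act h x).
  have xc : mdist x c = t by rewrite -[in LHS]gam0 iso// subr0.
  have chx : mdist c (act h x) = l - t by rewrite -[in LHS]gaml iso.
  by rewrite /between xc chx addrC subrK.
have chD : mean_dist c (act h x) = D / 2.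
  by have := mean_dist_between bc; rewrite tD -/D; lra.
(* An orbit point farther than [D / 2] from [c] would be more than [D] away from [x] or from
   [act h x], whichever lies across [c]; maximality and invariance exclude both. *)
have cle g : mean_dist c (act g x) <= D / 2.
  have [/mean_dist_between|/mean_dist_between] := between_branch treeT (act g x) bc.
    by have := hmax g; rewrite tD; lra.
  have := hmax (g^-1 * h)%g.
  rewrite -(mean_dist_act g) -(act_M act_cont g (g^-1 * h)%g) mulgA mulgV mul1g.
  by rewrite chD (mean_dist_sym (act g x) c); lra.
exists c; split; last by exists h.
move=> g; apply/mean_dist_eq0.
(* The point [act g c] is again a midpoint of two orbit points; if it differed from [c], one of them
   would be farther than [D / 2] from [c]. *)
have bgc := act_between g bc.
have e1 : mean_dist (act g x) (act g c) = D / 2 by rewrite mean_dist_act.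
have e2 : mean_dist (act g c) (act g (act h x)) = D / 2 by rewrite mean_dist_act.
have [/mean_dist_between|/mean_dist_between] := between_branch treeT c bgc.
  by have := cle g; rewrite e1 (mean_dist_sym (act g x) c); lra.
have := cle (g * h)%g; rewrite (act_M act_cont).
by rewrite e2 (mean_dist_sym c (act g c)); lra.
Qed.

End action.

(** * One-sided limits of monotone functions *)

Section ereal_limits.
Context {R : realType}.
Implicit Types (f : \bar R -> \bar R) (r y L : \bar R).

(** Since the values eventually stay at or above [L], only the right ends of neighborhoods of [L]
    have to be checked. *)
Lemma cvg_from_above {U : Type} {F : set_system U} {FF : Filter F}
    (f : U -> \bar R) L :
  (\forall u \near F, L <= f u)%E ->
  (forall y, (L < y)%E -> \forall u \near F, (f u < y)%E) -> f @ F --> L.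
Proof.
move=> fge flt A; rewrite itv_nbhsE => -[[l u] [/= o Li] sA].
suff : \forall w \near F, f w \in Interval l u by apply: filterS => w; exact: sA.
move: Li; rewrite itv_boundlr => /andP[lL Lu].
case: u o Lu {sA} => [b y|b] o Lu.
  rewrite (itv_open_ends_rside o) bnd_simp in Lu.
  have := flt y Lu; move: fge; apply: filterS2 => w Lw wy.
  rewrite itv_boundlr (le_trans lL) ?bnd_simp//=.
  by rewrite (itv_open_ends_rside o) bnd_simp.
move: fge; apply: filterS => w Lw.
by rewrite itv_boundlr (le_trans lL) ?bnd_simp//= (itv_open_ends_rinfty o).
Qed.

(** Monotonicity makes the infimum a limit; at a real point the filter is proper, so [lim] returns
    it. *)
Lemma cvg_right_lim f (r : R) : {homo f : x y / (x <= y)%E} ->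
  right_lim f r%:E = ereal_inf [set f y | y in [set y | (r%:E < y)%E]].
Proof.
move=> fmono; apply: cvg_lim => //.
  apply: Build_ProperFilter_ex => P [e /= e0 eP].
  exists (r + e / 2)%:E; apply: eP => /=; last by rewrite lte_fin ltrDl divr_gt0.
  rewrite opprD addrA subrr sub0r normrN gtr0_norm ?divr_gt0//.
  by rewrite ltr_pdivrMr// ltr_pMr// ltr1n.
apply: cvg_from_above.
  by rewrite near_withinE; apply: nearW => y ry; apply: ereal_inf_lbound; exists y.
move=> y /ereal_inf_lt[_ [z /= rz <-] fzy].
rewrite near_withinE.
have : nbhs r%:E [set w | w < z]%E by exact: open_ereal_lt'.
apply: filterS => w /= wz _; apply: le_lt_trans fzy; exact/fmono/ltW.
Qed.

Lemma ge_right_lim f (r : R) y : {homo f : x y / (x <= y)%E} ->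
  (r%:E < y)%E -> (right_lim f r%:E <= f y)%E.
Proof.
by move=> fm ry; rewrite cvg_right_lim//; apply: ereal_inf_lbound; exists y.
Qed.

Lemma le_right_lim f (r : R) L : {homo f : x y / (x <= y)%E} ->
  (forall y, (r%:E < y)%E -> (L <= f y)%E) -> (L <= right_lim f r%:E)%E.
Proof.
by move=> fm Lf; rewrite cvg_right_lim//; apply: le_ereal_inf_tmp => _ [y /= /Lf Ly <-].
Qed.

Lemma nonincreasing_at_left_lim (f : R -> \bar R) (a : R) :
  {homo f : x y / x <= y >-> (y <= x)%E} ->
  lim (f x @[x --> a^'-]) = ereal_inf [set f x | x in [set x | x < a]].
Proof.
move=> fm; apply: cvg_lim => //; apply: cvg_from_above.
  apply: filterS (nbhs_left_lt a) => x xa.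
  by apply: ereal_inf_lbound; exists x.
move=> y /ereal_inf_lt[_ [z /= za <-] fzy].
apply: filterS (nbhs_left_gt za) => x zx.
exact: le_lt_trans (fm _ _ (ltW zx)) fzy.
Qed.

End ereal_limits.

(** * Bounds for the separation distance *)

Section separation_bounds.
Context {R : realType} {G : metricGroupType R}.
Variable mu : probability (borel G) R.
Hypothesis compactG : compact [set: G].
Implicit Types (k : R).

Lemma compact_mdist_bounded : exists M : R, forall g h : G, mdist g h <= M.
Proof.
have c1 : continuous (fun g : G => mdist 1%g g).
  apply: (continuous_comp2 mdist_continuous) => [|g]; last exact: cvg_id.
  exact: cst_continuous.
have [M hM] := compact_continuous_bounded compactG c1.
exists (M + M) => g h; apply: (le_trans (metric_triangle _ 1%g _)).
by rewrite metric_sym lerD// (le_trans (ler_norm _)).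
Qed.

Lemma le_Sep k1 k2 k1' k2' : k1 <= k1' -> k2 <= k2' ->
  (Sep mu k1' k2' <= Sep mu k1 k2)%E.
Proof.
move=> k11 k22; apply: ereal_sup_le => _ [AB [mA mB kA kB] <-]; exists AB => //.
by split=> //; [apply: le_trans kA|apply: le_trans kB]; rewrite lee_fin.
Qed.

Lemma set_dist_le_Sep (A B : set G) k1 k2 :
  measurable (A : set (borel G)) -> measurable (B : set (borel G)) ->
  (k1%:E <= mu A)%E -> (k2%:E <= mu B)%E ->
  (set_dist A B <= Sep mu k1 k2)%E.
Proof. by move=> mA mB kA kB; apply: ereal_sup_ubound; exists (A, B). Qed.

Lemma Sep_ge0 k1 k2 : k1 <= 1 -> k2 <= 1 -> (0 <= Sep mu k1 k2)%E.
Proof.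
move=> k11 k21.
apply: le_trans (@set_dist_le_Sep setT setT k1 k2 _ _ _ _) => //.
- by apply: le_ereal_inf_tmp => _ [a _ [b _ <-]]; rewrite lee_fin mdist_ge0.
- by rewrite [leRHS](@probability_setT _ _ _ mu) lee_fin.
- by rewrite [leRHS](@probability_setT _ _ _ mu) lee_fin.
Qed.

(** Sets of positive measure are nonempty, so their distance is at most a bound for the metric of
    the compact group. Finiteness of [Sep] is what makes right limits there meaningful. *)
Lemma Sep_bounded : exists M : R, forall k1 k2, 0 < k1 -> 0 < k2 ->
  (Sep mu k1 k2 <= M%:E)%E.
Proof.
have [M hM] := compact_mdist_bounded; exists M => k1 k2 k10 k20.
apply: ge_ereal_sup => _ [[A B] /= [mA mB kA kB] <-].
have ne k (C : set (borel G)) : 0 < k -> (k%:E <= mu C)%E -> exists c : G, C c.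
  move=> k0 kC; apply/set0P/eqP => C0.
  by move: kC; rewrite C0 measure0 lee_fin leNgt k0.
have [a Aa] := ne _ _ k10 kA; have [b Bb] := ne _ _ k20 kB.
apply: ge_ereal_inf; exists (mdist a b)%:E; last by rewrite lee_fin.
by exists a => //; exists b.
Qed.

End separation_bounds.

(** * The moduli [omega] and [rho] *)

Section moduli.
Context {R : realType} {G : metricGroupType R} {T : completeMetricType R}.
Variable act : G -> T -> T.
Hypothesis compactG : compact [set: G].
Hypothesis act_cont : is_continuous_action act.
Implicit Types (x y : T) (g h : G) (eta : \bar R).

Lemma le_omega x : {homo omega act x : a b / (a <= b)%E}.
Proof.
move=> a b ab; apply: ereal_sup_le => _ [p /= pa <-]; exists p => //=.
exact: le_trans ab.
Qed.

Lemma le_rho : {homo rho act : a b / (a <= b)%E}.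
Proof.
move=> a b ab; apply: ereal_sup_le => _ [p /= pa <-]; exists p => //=.
exact: le_trans ab.
Qed.

Lemma mdist_le_omega x eta g h : ((mdist g h)%:E <= eta)%E ->
  ((mdist (act g x) (act h x))%:E <= omega act x eta)%E.
Proof. by move=> gh; apply: ereal_sup_ubound; exists (g, h). Qed.

Lemma mdist_le_rho eta g x y : ((mdist x y)%:E <= eta)%E ->
  ((mdist (act g x) (act g y))%:E <= rho act eta)%E.
Proof. by move=> xy; apply: ereal_sup_ubound; exists (g, (x, y)). Qed.

Lemma omega_ge0 x eta : (0 <= eta)%E -> (0 <= omega act x eta)%E.
Proof.
move=> eta0; apply: le_trans (@mdist_le_omega x eta 1%g 1%g _).
  by rewrite lee_fin mdist_ge0.
by rewrite mdistxx.
Qed.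

Lemma rho_ge0 eta (x : T) : (0 <= eta)%E -> (0 <= rho act eta)%E.
Proof.
move=> eta0; apply: le_trans (@mdist_le_rho eta 1%g x x _).
  by rewrite lee_fin mdist_ge0.
by rewrite mdistxx.
Qed.

(** An orbit of a compact group is bounded, whatever the value of [eta]. *)
Lemma omega_lty x eta : (omega act x eta < +oo)%E.
Proof.
have c1 : continuous (fun g : G => mdist x (act g x)).
  apply: (continuous_comp2 mdist_continuous); first exact: cst_continuous.
  exact: act_continuousl.
have [M hM] := compact_continuous_bounded compactG c1.
apply: (@le_lt_trans _ _ (M + M)%:E); last exact: ltry.
apply: ge_ereal_sup => _ [[g h] /= _ <-]; rewrite lee_fin.
apply: (le_trans (metric_triangle _ x _)).
by rewrite metric_sym lerD// (le_trans (ler_norm _)).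
Qed.

End moduli.

(** * Branches of the orbit at a fixed point *)

Section branches.
Context {R : realType} {G : metricGroupType R} {T : completeMetricType R}.
Variables (mu : probability (borel G) R) (act : G -> T -> T).
Hypothesis compactG : compact [set: G].
Hypothesis haar_mu : is_haar mu.
Hypothesis treeT : is_Rtree T.
Hypothesis act_cont : is_continuous_action act.
Variables (x c : T).
Hypothesis fix_c : forall g, act g c = c.
Hypothesis x_neq_c : forall g, act g x <> c.
Implicit Types (g h : G).

(** The elements carrying [x] into the component of the complement of [c] that contains [act h x]:
    points other than [c] lie in different components exactly when [c] is between them. *)
Definition branch h : set G := [set g | ~ between (act h x) c (act g x)].

Lemma branch_refl h : branch h h.
Proof.
move=> b; apply: (@x_neq_c h); apply: mdist_positivity; move: b.
rewrite /between mdistxx (metric_sym c); lra.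
Qed.

(** If [act g' x] is nearer to [act g x] than [c] is, then [c] is not between the two, so they lie
    on the same branch. *)
Lemma branch_open h : open (branch h).
Proof.
rewrite openE => g /= hg.
have d0 : 0 < mdist (act g x) c by rewrite mdist_gt0; apply/eqP; exact: x_neq_c.
have : act^~ x @ g --> act g x by exact: act_continuousl.
move=> /(@metricType_numDomainType.cvgrPdist_lt R T)/(_ _ d0).
apply: filterS => g' gg' bh.
have [//|b] := between_branch treeT (act g x) bh.
have := mdist_ge0 c (act g' x); move: b gg'; rewrite /between; lra.
Qed.

Lemma branch_measurable h : measurable (branch h : set (borel G)).
Proof. by apply: sub_sigma_algebra; exact: branch_open. Qed.

(** Acting by [h] fixes [c] and preserves betweenness, so left translation by [h] carries the branch
    of 1 onto that of [h]. *)
Lemma measure_branch h : mu (branch h) = mu (branch 1%g).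
Proof.
rewrite -[RHS](haar_lmul haar_mu h^-1%g (branch_measurable 1%g)); congr (mu _).
have fwd k p q : between p c q -> between (act k p) c (act k q).
  by move=> /(act_between treeT act_cont k); rewrite fix_c.
apply/seteqP; split=> g; rewrite /branch/= (act_1 act_cont) => nb b; apply: nb.
  by move: (fwd h _ _ b); rewrite -(act_M act_cont) mulgA mulgV mul1g.
by move: (fwd h^-1%g _ _ b); rewrite -!(act_M act_cont) mulVg (act_1 act_cont).
Qed.

Variable h0 : G.
Hypothesis between_c : between x c (act h0 x).

(** As [c] separates [x] from [act h0 x], the branches of 1 and [h0] are disjoint, and their
    measures agree. *)
Lemma measure_branch_le_half : (mu (branch 1%g) <= (1 / 2)%:E)%E.
Proof.
have dis : branch 1%g `&` branch h0 = set0.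
  apply/seteqP; split=> // g; rewrite /branch/= (act_1 act_cont) => -[n1 n2].
  have [//|b] := between_branch treeT (act g x) between_c.
  by apply: n2; exact: between_sym.
have mb := branch_measurable.
have : (mu (branch 1%g `|` branch h0) <= 1)%E.
  by apply: probability_le1; exact: measurableU.
have -> : mu (branch 1%g `|` branch h0) = (mu (branch 1%g) + mu (branch h0))%E.
  exact: (measureU _ (mb _) (mb _) dis).
rewrite measure_branch.
have : mu (branch 1%g) \is a fin_num by exact: fin_num_measure.
case: (mu (branch 1%g)) => [m| |]// _.
by rewrite -EFinD !lee_fin; lra.
Qed.

Definition branches (s : seq G) : set G := [set g | exists2 h, h \in s & branch h g].

Lemma branches_cons h s : branches (h :: s) = branch h `|` branches s.
Proof.
apply/seteqP; split=> g /=.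
  by move=> [k]; rewrite inE => /predU1P[->|ks] kg; [left|right; exists k].
move=> [hg|[k ks kg]]; first by exists h => //; rewrite mem_head.
by exists k => //; rewrite inE ks orbT.
Qed.

Lemma branches_measurable s : measurable (branches s : set (borel G)).
Proof.
elim: s => [|h s IH]; last first.
  by rewrite branches_cons; apply: measurableU => //; exact: branch_measurable.
by rewrite (_ : branches [::] = set0)//; apply/seteqP; split=> // g [].
Qed.

Lemma branches_cover : exists s, branches s = setT.
Proof.
have : @cover_compact G [set: G] by rewrite -compact_cover.
move=> /(_ G setT branch (fun h _ => branch_open h)).
case=> [g _|D _ cD]; first by exists g => //; exact: branch_refl.
exists (finmap.enum_fset D); by apply/seteqP; split.
Qed.

(* Adding the branches, of equal measure at most 1/2, one at a time, the first
   union of measure at least 1/4 has measure at most 3/4. *)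
Lemma balanced_branches :
  exists s, ((1 / 4)%:E <= mu (branches s) <= (3 / 4)%:E)%E.
Proof.
have [s sT] := branches_cover.
have : ((1 / 4)%:E <= mu (branches s))%E.
  by rewrite sT [leRHS](@probability_setT _ _ _ mu) lee_fin; lra.
elim: {sT} s => [|h s IH] hs.
  move: hs; rewrite (_ : branches [::] = set0) ?measure0 ?lee_fin; first lra.
  by apply/seteqP; split=> // g [].
have [/IH//|small] := leP (1 / 4)%:E (mu (branches s)).
exists (h :: s); rewrite hs/= branches_cons.
have m1 := branch_measurable h; have m2 := branches_measurable s.
apply: (le_trans (measureU2 mu m1 m2)).
have -> : (3 / 4)%:E = ((1 / 2)%:E + (1 / 4)%:E :> \bar R)%E.
  by rewrite -EFinD; congr EFin; lra.
by apply: leeD; [rewrite [leLHS]measure_branch measure_branch_le_half|exact: ltW].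
Qed.

(** Take a balanced union of branches and its complement: an element of the complement lies on none
    of the chosen branches, so [c] separates its image of [x] from theirs. *)
Lemma branch_separation : exists A B : set G,
  [/\ measurable (A : set (borel G)), measurable (B : set (borel G)),
      ((1 / 4)%:E <= mu A)%E, ((1 / 4)%:E <= mu B)%E &
      forall a b, A a -> B b -> between (act a x) c (act b x)].
Proof.
have [s /andP[s1 s2]] := balanced_branches.
have ms := branches_measurable s.
exists (branches s), (~` branches s); split => //.
- exact: measurableC.
- rewrite [leRHS](probability_setC mu ms).
  have : mu (branches s) \is a fin_num by exact: fin_num_measure.
  by move: s2; case: (mu _) => [m| |]//; rewrite -EFinB !lee_fin => + _; lra.
- move=> a b [h hs ha] nb.
  have hb : between (act h x) c (act b x).
    by apply: contrapT => nhb; apply: nb; exists h.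
  by have [] := between_branch treeT (act a x) hb.
Qed.

End branches.

(** * From separation to displacement *)

Section main.
Context {R : realType} {G : metricGroupType R} {T : completeMetricType R}.
Variables (mu : probability (borel G) R) (act : G -> T -> T).
Hypothesis compactG : compact [set: G].
Hypothesis haar_mu : is_haar mu.
Hypothesis treeT : is_Rtree T.
Hypothesis act_cont : is_continuous_action act.

(** [Sep mu k k] does not increase with [k], so the left limit is an infimum; its value at 1/8
    bounds it. *)
Lemma Sep_left_lim : let r := lim (Sep mu k k @[k --> (1 / 4)^'-]) in
  [/\ r \is a fin_num, (0 <= r)%E &
    forall L, (forall k, k < 1 / 4 -> (L <= Sep mu k k)%E) -> (L <= r)%E].
Proof.
rewrite /= nonincreasing_at_left_lim; last by move=> k k' kk'; exact: le_Sep.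
set r := ereal_inf _.
have ler L : (forall k, k < 1 / 4 -> (L <= Sep mu k k)%E) -> (L <= r)%E.
  by move=> Lk; apply: le_ereal_inf_tmp => _ [k /= k4 <-]; exact: Lk.
have r0 : (0 <= r)%E by apply: ler => k k4; apply: Sep_ge0; lra.
split=> //; rewrite ge0_fin_numE//.
have [M hM] := Sep_bounded mu compactG.
apply: (@le_lt_trans _ _ M%:E); last exact: ltry.
apply: ge_ereal_inf; exists (Sep mu (1 / 8) (1 / 8)); last by apply: hM; lra.
by exists (1 / 8) => //=; lra.
Qed.

Lemma right_lim_omega x (r : \bar R) : r \is a fin_num -> (0 <= r)%E ->
  let w := right_lim (omega act x) r in w \is a fin_num /\ (0 <= w)%E.
Proof.
case: r => // r _ r0; have om := @le_omega R G T act x.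
have w0 : (0 <= right_lim (omega act x) r%:E)%E.
  apply: le_right_lim => // y ry; apply: omega_ge0.
  exact: le_trans (ltW ry).
split=> //; rewrite ge0_fin_numE//.
apply: (@le_lt_trans _ _ (omega act x (r + 1)%:E)).
  by apply: ge_right_lim => //; rewrite lte_fin ltrDl.
exact: omega_lty.
Qed.

(* Two complementary unions of branches at [c], of measure at least 1/4, contain
   nearby elements a and b, and the geodesic from ax to bx passes through [c]. *)
Lemma orbit_near_center x c h : (forall g, act g c = c) ->
  between x c (act h x) ->
  exists g, forall eta,
    (lim (Sep mu k k @[k --> (1 / 4)^'-]) < eta)%E ->
    ((mdist (act g x) c)%:E <= omega act x eta)%E.
Proof.
move=> fix_c bc; have [_ r0 ler] := Sep_left_lim.
have [[g <-]|nx] := pselect (exists g, act g x = c).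
  exists g => eta reta; rewrite mdistxx; apply: omega_ge0 => //.
  exact: le_trans (ltW reta).
have x_neq_c g : act g x <> c by move=> gxc; apply: nx; exists g.
have [A [B [mA mB A4 B4 AB]]] :=
  branch_separation compactG haar_mu treeT act_cont fix_c x_neq_c bc.
have dAB : (set_dist A B <= lim (Sep mu k k @[k --> (1 / 4)^'-]))%E.
  apply: ler => k k4; apply: set_dist_le_Sep => //.
    by apply: le_trans A4; rewrite lee_fin ltW.
  by apply: le_trans B4; rewrite lee_fin ltW.
have cd : continuous (fun g => mdist (act g x) c).
  apply: (continuous_comp2 mdist_continuous); last exact: cst_continuous.
  exact: act_continuousl.
have G0 : [set: G] !=set0 by exists 1%g.
(* Taking the orbit point closest to [c] makes [g] independent of [eta]. *)
have [g _ gmin] := compact_EVT_min G0 compactG (continuous_subspaceT cd).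
exists g => eta /(le_lt_trans dAB)/ereal_inf_lt[_ [a Aa [b Bb <-]] dab].
apply: (le_trans _ (mdist_le_omega act x (ltW dab))); rewrite lee_fin.
apply: (@le_trans _ _ (mdist (act a x) c)); first by apply: gmin; rewrite inE.
by rewrite -(AB a b)// lerDl mdist_ge0.
Qed.

End main.

Theorem proposition3p10 (R : realType) (G : metricGroupType R)
    (mu : probability (borel G) R) (T : completeMetricType R)
    (act : G -> T -> T)
    (compactG : compact [set: G]) (haar_mu : is_haar mu)
    (treeT : is_Rtree T) (act_cont : is_continuous_action act) :
  (forall (x : T) (kappa : R), 0 < kappa < 1 / 4 ->
    let w := right_lim (omega act x) (Sep mu kappa (1 / 3)) in
    exists z : T, forall g : G,
      ((mdist z (act g z))%:E <= w + rho act w)%E) /\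
  (let r : \bar R := lim (Sep mu kappa kappa @[kappa --> (1 / 4)^'-]) in
   forall x : T,
     let w := right_lim (omega act x) r in
     exists2 z : T, z \in act_orbit act x & forall g : G,
       ((mdist z (act g z))%:E <=
         mine (2%:E * w + right_lim (rho act) (2%:E * w))
              (2%:E * w + 2%:E * rho act w))%E).
Proof.
split=> [x kappa /andP[k0 k4] w|r x w].
  have [c [fix_c _]] := orbit_center compactG haar_mu treeT act_cont x.
  (* A fixed point has displacement 0, so only nonnegativity of the bound is left. *)
  exists c => g; rewrite fix_c mdistxx.
  have S0 : (0 <= Sep mu kappa (1 / 3))%E by apply: Sep_ge0; lra.
  have Sfin : Sep mu kappa (1 / 3) \is a fin_num.
    have [M hM] := Sep_bounded mu compactG.
    rewrite ge0_fin_numE//; apply: (@le_lt_trans _ _ M%:E); last exact: ltry.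
    by apply: hM; lra.
  have [_ w0] := right_lim_omega compactG act_cont x Sfin S0.
  by apply: adde_ge0 => //; exact: rho_ge0.
have [c [fix_c [h bc]]] := orbit_center compactG haar_mu treeT act_cont x.
have [g0 near_c] := orbit_near_center compactG haar_mu treeT act_cont fix_c bc.
have [rfin r0 _] := Sep_left_lim mu compactG.
have [wfin w0] := right_lim_omega compactG act_cont x rfin r0.
rewrite -/r -/w in near_c rfin r0 wfin w0.
have zw : ((mdist (act g0 x) c)%:E <= w)%E.
  rewrite /w -(fineK rfin); apply: le_right_lim => [|y]; first exact: le_omega.
  by rewrite fineK//; exact: near_c.
set z := act g0 x in zw *.
exists z => [|g]; first by rewrite inE; exists g0.
have zgz : ((mdist z (act g z))%:E <= w + rho act w)%E.
  apply: (@le_trans _ _ ((mdist z c)%:E + (mdist c (act g z))%:E)%E).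
    by rewrite -EFinD lee_fin metric_triangle.
  apply: leeD => //; rewrite -{1}(fix_c g); apply: mdist_le_rho.
  by rewrite metric_sym.
have w2w : (w <= 2%:E * w)%E by rewrite lee_pemull// lee1n.
have rw0 : (0 <= rho act w)%E by exact: rho_ge0.
(* For the first bound, [rho] at [w] is at most [rho] at [2%:E * w], hence at most its right limit
   there; for the second, doubling nonnegative terms suffices. *)
rewrite le_min; apply/andP; split; apply: (le_trans zgz); apply: leeD => //.
  apply: (@le_trans _ _ (rho act (2%:E * w))%E); first exact: le_rho.
  rewrite -(fineK wfin) -EFinM; apply: le_right_lim; first exact: le_rho.
  by move=> y /ltW yw; exact: le_rho.
by rewrite lee_pemull// lee1n.
Qed.
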